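(* Consider a regular spherically symmetric, asymptotically flat initial data set for the Einstein–Maxwell equations (with no magnetic charge). Assume there is a ball $\mathcal{B}=\{l\le l_0\}$ of finite area radius $\mathcal{R}=r(l_0)>0$ such that outside $\mathcal{B}$ (i.e. for $l\ge l_0$) the data are electrovacuum, and such that the dominant energy condition $\mu\ge |j|$ holds in $\mathcal{B}$. Let $Q$ be the total charge of $\mathcal{B}$ and assume $Q\neq 0$. Then: (i) If the exterior region $\{l\ge l_0\}$ is untrapped, then $2\mathcal{R}>|Q|$. (ii) If there is a horizon outside $\mathcal{B}$, then its area radius $\mathcal{R}_0$ satisfies $\mathcal{R}_0\ge |Q|$; equality holds for the horizon of the extreme Reissner–Nordström black hole ($M=|Q|$).
   Context: Regular spherically symmetric initial data: the manifold is $\mathbb{R}^3$ with metric $h=dl^2+r(l)^2(d\theta^2+\sin^2\theta\,d\phi^2)$, where $l\ge0$ is the geodesic distance to the center and $r(l)$ (the area radius) is smooth on $[0,\infty)$ with $r(0)=0$, $r'(0)=1$. The second fundamental form is $K_{ij}=n_in_jK_l+(h_{ij}-n_in_j)K_r$ with $n=\partial_l$ and functions $K_l(l),K_r(l)$. The constraint equations are $K_r(K_r+2K_l)-\frac{1}{r^2}(r'^2+2rr''-1)=8\pi\mu$, $\;K_r'+\frac{r'}{r}(K_r-K_l)=4\pi j$, where $\mu$ is the energy density and $j$ the radial momentum density. The dominant energy condition is $\mu\ge|j|$. The electric and magnetic fields are radial, $E=E^in_i$, $B=B^in_i$, satisfying $\frac{1}{r^2}(Er^2)'=4\pi\rho$,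 $\frac1{r^2}(Br^2)'=0$ with $\rho$ the charge density; no magnetic charges means $B=0$. Also $\mu=\mu_M+\frac1{8\pi}(E^2+B^2)$ with $\mu_M$ the non-electromagnetic energy density. Electrovacuum means $\mu_M=0$, $j=0$, $\rho=0$. The charge of $\mathcal{B}$ is $Q=4\pi\int_0^{l_0}\rho r^2\,dl=E(l_0)r(l_0)^2$. Asymptotic flatness: in Cartesian coordinates $h_{ij}=\delta_{ij}+\gamma_{ij}$ with $\gamma_{ij}=O(r^{-1})$, $\partial\gamma=O(r^{-2})$, $\partial^2\gamma=O(r^{-3})$, $K_{ij}=O(r^{-2})$, $\partial K=O(r^{-3})$; in particular $r(l)\to\infty$, $r'\to1$, $rK_r\to0$ as $l\to\infty$. Null expansions of the sphere at $l$: $\theta^\pm=\frac2r(r'\pm K_r r)$. A region between two concentric spheres is untrapped if $\theta^+\theta^->0$ there and trapped if $\theta^+\theta^-<0$. A horizon is the outer boundary of a trapped region; it satisfies $\theta^+\theta^-=0$, and $\mathcal{R}_0$ denotes its area radius. The mass $M$ of the data is the ADM mass, equal to $\lim_{l\to\infty}\mathcal{E}$ where $\mathcal{E}=\frac r2\bigl(1-\frac{r^2}{4}\theta^+\theta^-\bigr)$ is the Misner–Sharp energy. *)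

(* Defs.v *)
From Stdlib Require Import Reals Lra.
Open Scope R_scope.

Definition smooth (f : R -> R) : Prop :=
  exists D : nat -> R -> R,
    D 0%nat = f /\ forall (n : nat) (x : R), derivable_pt_lim (D n) x (D (S n) x).

Definition tends_to_at_infty (f : R -> R) (a : R) : Prop :=
  forall eps : R, 0 < eps -> exists L : R, forall l : R, L <= l -> Rabs (f l - a) < eps.

Definition tends_to_infty (f : R -> R) : Prop :=
  forall M : R, exists L : R, forall l : R, L <= l -> M <= f l.

Definition theta_plus (r r1 Kr : R -> R) (l : R) : R := 2 / r l * (r1 l + Kr l * r l).
Definition theta_minus (r r1 Kr : R -> R) (l : R) : R := 2 / r l * (r1 l - Kr l * r l).
Definition theta_prod (r r1 Kr : R -> R) (l : R) : R :=
  theta_plus r r1 Kr l * theta_minus r r1 Kr l.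

(* The sphere at l1 is a horizon: outer boundary of a trapped region
   (a, l1) between two concentric spheres, with theta+ theta- = 0 at l1. *)
Definition is_horizon (r r1 Kr : R -> R) (l1 : R) : Prop :=
  theta_prod r r1 Kr l1 = 0 /\
  exists a : R, 0 <= a /\ a < l1 /\
    forall l : R, a < l < l1 -> theta_prod r r1 Kr l < 0.

(* Main.v *)
(* In the electrovacuum exterior the charge [Q = E r^2] and the mass
   [M = E_MS + Q^2 / (2 r)] are constant (E_MS the Misner–Sharp energy), so there
   [r^2 theta+ theta- / 4 = r^2 - 2 M r + Q^2], as for Reissner–Nordström.
   (i) If the exterior is untrapped, [r' > 0] on the boundary of the ball; wherever E_MS < 0
   inside the ball, [r' > |K_r r|], and the dominant energy condition makes E_MS nondecreasing,
   so [E_MS(l0) >= 0] and [M >= Q^2 / (2 R)]. If [2 R <= |Q|], the quadratic would be [<= 0] at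
   the radius [Q^2 / (2 R)], which [r] attains outside the ball.
   (ii) A horizon of radius [R0 < |Q|] is the smaller root of the quadratic. If [r' > 0] there,
   the constraints make [theta+ theta-] strictly decreasing through the horizon, contradicting
   the trapped region inside it. Otherwise [r] decreases past the horizon ([r'' < 0] if
   [r' = 0]) and, since [r -> oo], has a critical point of radius [< R0], where
   [theta+ theta- <= 0] although the quadratic is positive below its smaller root. *)

Require Import Defs.
From Stdlib Require Import Reals Lra.
From Coquelicot Require Import Coquelicot.
Open Scope R_scope.

(* Stated for [fun y => f y], the eta-expanded form that [auto_derive] produces. *)
Lemma Derive_of_derivable_pt_lim f x d : derivable_pt_lim f x d -> Derive (fun y => f y) x = d.
Proof. intro H. apply is_derive_unique, is_derive_Reals, H. Qed.

Lemma ex_derive_of_derivable_pt_lim f x d : derivable_pt_lim f x d -> ex_derive f x.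
Proof. intro H. exists d. apply is_derive_Reals, H. Qed.

Lemma continuity_of_derivable_pt_lim f f' :
  (forall x, derivable_pt_lim f x (f' x)) -> continuity f.
Proof. intros H x. apply derivable_continuous_pt. exists (f' x). apply H. Qed.

Lemma derivable_pt_lim_neg_local f x d : derivable_pt_lim f x d -> d < 0 ->
  exists del, 0 < del /\ forall h, 0 < h < del -> f (x + h) < f x < f (x - h).
Proof.
  intros H Hd. destruct (H (- d / 2)) as [del Hdel]; [lra|].
  exists del; split; [apply cond_pos|]. intros h [h0 h1].
  assert (Hr := Hdel h ltac:(lra) ltac:(rewrite Rabs_right; lra)).
  assert (Hl := Hdel (- h) ltac:(lra) ltac:(rewrite Rabs_left; lra)).
  apply Rabs_def2 in Hr as [Hr1 Hr2]. apply Rabs_def2 in Hl as [Hl1 Hl2].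
  replace (x + - h) with (x - h) in * by ring.
  assert (Er : f (x + h) - f x = (f (x + h) - f x) / h * h) by (field; lra).
  assert (El : f (x - h) - f x = (f (x - h) - f x) / - h * - h) by (field; lra).
  split; nra.
Qed.

Lemma continuity_pt_neg_nbhd g x : continuity_pt g x -> g x < 0 ->
  exists del, 0 < del /\ forall y, Rabs (y - x) < del -> g y < 0.
Proof.
  intros Hc Hx. destruct (Hc (- g x) ltac:(lra)) as [del [Hdel Hy]].
  exists del; split; [lra|]. intros y Hyx.
  destruct (Req_dec y x) as [->|Hne]; [lra|].
  assert (Hd : R_dist (g y) (g x) < - g x) by (apply Hy; repeat split; auto).
  unfold R_dist in Hd. apply Rabs_def2 in Hd. lra.
Qed.

Lemma last_nonneg_point g a c : continuity g -> a <= c -> 0 <= g a -> g c < 0 ->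
  exists b, a <= b < c /\ 0 <= g b /\ forall y, b < y <= c -> g y < 0.
Proof.
  intros Hg Hac Ha Hc.
  set (S x := a <= x <= c /\ 0 <= g x).
  destruct (completeness S) as [b [Hub Hlub]].
  - exists c. intros x [Hx _]. lra.
  - exists a. split; [lra | exact Ha].
  assert (Hab : a <= b) by (apply Hub; split; [lra | exact Ha]).
  assert (Hbc : b <= c) by (apply Hlub; intros x [Hx _]; lra).
  assert (Hafter : forall y, b < y <= c -> g y < 0).
  { intros y Hy. destruct (Rlt_or_le (g y) 0) as [Hlt|Hge]; [exact Hlt|].
    assert (y <= b) by (apply Hub; split; lra). lra. }
  assert (Hb : 0 <= g b).
  { destruct (Rle_or_lt 0 (g b)) as [Hge|Hlt]; [exact Hge|exfalso].
    destruct (continuity_pt_neg_nbhd g b (Hg b) Hlt) as [del [Hdel Hnb]].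
    assert (b <= b - del / 2); [|lra].
    apply Hlub. intros x [Hx Hgx].
    destruct (Rle_or_lt x (b - del / 2)) as [Hle|Hgt]; [exact Hle|exfalso].
    assert (x <= b) by (apply Hub; split; auto).
    assert (g x < 0) by (apply Hnb, Rabs_def1; lra). lra. }
  exists b. repeat split; auto.
  destruct (Rle_lt_or_eq_dec _ _ Hbc) as [Hlt| ->]; [exact Hlt|lra].
Qed.

Lemma pos_of_no_root g a b : continuity g -> a <= b -> 0 < g b ->
  (forall x, a <= x <= b -> g x <> 0) -> 0 < g a.
Proof.
  intros Hg Hab Hb Hroot.
  destruct (Rlt_or_le 0 (g a)) as [Hpos|Hle]; [exact Hpos|exfalso].
  destruct (IVT_cor g a b Hg Hab ltac:(nra)) as [z [Hz Hgz]].
  exact (Hroot z Hz Hgz).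
Qed.

Lemma le_of_derivative_nonneg f f' a b : a <= b -> continuity f ->
  (forall c, a < c < b -> derivable_pt_lim f c (f' c)) ->
  (forall c, a < c < b -> 0 <= f' c) -> f a <= f b.
Proof.
  intros Hab Hc Hd Hpos. destruct (Rle_lt_or_eq_dec _ _ Hab) as [Hlt| ->]; [|lra].
  destruct (MVT f id a b (fun c Hc => exist _ (f' c) (Hd c Hc)) (fun c _ => derivable_pt_id c)
              Hlt (fun c _ => Hc c) (fun c _ => derivable_continuous_pt id c (derivable_pt_id c)))
    as [c [Hcab Hmvt]].
  rewrite derive_pt_id in Hmvt. simpl in Hmvt.
  specialize (Hpos c Hcab). unfold id in Hmvt. nra.
Qed.

Lemma eq_of_derivative_zero f f' a b : a <= b ->
  (forall c, a <= c <= b -> derivable_pt_lim f c (f' c)) ->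
  (forall c, a < c < b -> f' c = 0) -> f b = f a.
Proof.
  intros Hab Hd Hzero. destruct (Rle_lt_or_eq_dec _ _ Hab) as [Hlt| ->]; [|lra].
  destruct (MVT_cor2 f f' a b Hlt Hd) as [c [Hc Hcab]].
  rewrite (Hzero c Hcab) in Hc. lra.
Qed.

Lemma tends_to_infty_reaches f a t : continuity f -> tends_to_infty f -> f a <= t ->
  exists z, a <= z /\ f z = t.
Proof.
  intros Hc Hinf Ht. destruct (Hinf t) as [L HL].
  set (b := Rmax L a).
  assert (Hb : t <= f b) by (apply HL, Rmax_l).
  destruct (IVT_cor (fun x => f x - t) a b) as [z [Hz Hfz]].
  - apply continuity_minus; [exact Hc | apply continuity_const; now intros ? ?].
  - apply Rmax_r.
  - nra.
  - exists z. split; lra.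
Qed.

Lemma exists_critical_point_below f f' a b :
  (forall x, derivable_pt_lim f x (f' x)) -> tends_to_infty f -> a < b -> f b < f a ->
  exists m, a < m /\ f m < f a /\ f' m = 0.
Proof.
  intros Hd Hinf Hab Hba.
  destruct (Hinf (f a + 1)) as [L HL].
  set (c := Rmax L b + 1).
  assert (Hc : f a + 1 <= f c) by (apply HL; unfold c; pose proof (Rmax_l L b); lra).
  assert (Hbc : b < c) by (unfold c; pose proof (Rmax_r L b); lra).
  destruct (continuity_ab_min f a c ltac:(lra)
              (fun x _ => continuity_of_derivable_pt_lim f f' Hd x)) as [m [Hmin Hm]].
  assert (Hfm : f m < f a) by (pose proof (Hmin b ltac:(lra)); lra).
  assert (Ham : a < m).
  { destruct (Rle_lt_or_eq_dec _ _ (proj1 Hm)) as [Hlt| <-]; [exact Hlt|lra]. }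
  assert (Hmc : m < c).
  { destruct (Rle_lt_or_eq_dec _ _ (proj2 Hm)) as [Hlt| ->]; [exact Hlt|lra]. }
  exists m. repeat split; auto.
  exact (deriv_minimum f a c m (exist _ (f' m) (Hd m)) Ham Hmc
           (fun x Hax Hxc => Hmin x ltac:(lra))).
Qed.

Lemma exists_right_lt_of_second_derivative_neg f f' x d :
  (forall y, derivable_pt_lim f y (f' y)) -> derivable_pt_lim f' x d ->
  f' x = 0 -> d < 0 -> exists y, x < y /\ f y < f x.
Proof.
  intros Hd Hd2 Hx Hneg.
  destruct (derivable_pt_lim_neg_local f' x d Hd2 Hneg) as [del [Hdel Hloc]].
  exists (x + del / 2). split; [lra|].
  destruct (MVT_cor2 f f' x (x + del / 2) ltac:(lra) (fun c _ => Hd c)) as [c [Hc Hcx]].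
  assert (f' c < 0).
  { replace c with (x + (c - x)) by ring. rewrite <- Hx. apply Hloc. lra. }
  nra.
Qed.

Lemma dominant_energy_flux_nonneg mu j a b :
  Rabs j <= mu -> b ^ 2 <= a ^ 2 -> 0 <= a -> 0 <= mu * a + j * b.
Proof.
  intros Hj Hb Ha.
  assert (Hba : Rabs b <= a).
  { rewrite <- (Rabs_pos_eq a Ha). apply Rsqr_le_abs_0. unfold Rsqr. lra. }
  pose proof (Rabs_pos j). pose proof (Rabs_pos b).
  assert (Rabs (j * b) <= mu * a) by (rewrite Rabs_mult; apply Rmult_le_compat; lra).
  pose proof (Rle_abs (- (j * b))). rewrite Rabs_Ropp in *. lra.
Qed.

Lemma quadratic_pos_below_smaller_root M Q s x :
  0 < x < s -> s ^ 2 < Q ^ 2 -> s ^ 2 - 2 * M * s + Q ^ 2 = 0 ->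
  0 < x ^ 2 - 2 * M * x + Q ^ 2.
Proof. intros Hx HsQ Hs. assert (s < M) by nra. nra. Qed.

Definition scaled_theta_prod (r r1 Kr : R -> R) (l : R) : R := r1 l ^ 2 - (r l * Kr l) ^ 2.

Definition misner_sharp (r r1 Kr : R -> R) (l : R) : R :=
  r l * (1 - scaled_theta_prod r r1 Kr l) / 2.

Section EinsteinMaxwellData.

Variables (r r1 r2 Kl Kr Kr1 E E1 mu muM j rho : R -> R) (l0 : R).
Hypotheses (Hr1 : forall l, derivable_pt_lim r l (r1 l))
  (Hr2 : forall l, derivable_pt_lim r1 l (r2 l))
  (HKr1 : forall l, derivable_pt_lim Kr l (Kr1 l))
  (HE1 : forall l, derivable_pt_lim E l (E1 l))
  (Hr0 : r 0 = 0) (Hrpos : forall l, 0 < l -> 0 < r l)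
  (Hham : forall l, 0 < l ->
     Kr l * (Kr l + 2 * Kl l) - (r1 l ^ 2 + 2 * r l * r2 l - 1) / r l ^ 2
       = 8 * PI * mu l)
  (Hmom : forall l, 0 < l -> Kr1 l + r1 l / r l * (Kr l - Kl l) = 4 * PI * j l)
  (Hmax : forall l, 0 < l ->
     (E1 l * r l ^ 2 + 2 * E l * r l * r1 l) / r l ^ 2 = 4 * PI * rho l)
  (Hmu : forall l, 0 < l -> mu l = muM l + E l ^ 2 / (8 * PI))
  (Hl0 : 0 < l0)
  (Hvac : forall l, l0 <= l -> muM l = 0 /\ j l = 0 /\ rho l = 0)
  (Hdec : forall l, 0 < l <= l0 -> Rabs (j l) <= mu l)
  (Haf_r : tends_to_infty r)
  (Haf_r1 : tends_to_at_infty r1 1).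

Local Notation P := (scaled_theta_prod r r1 Kr).
Local Notation En := (misner_sharp r r1 Kr).
Local Notation Q := (E l0 * r l0 ^ 2).
Local Notation M := (En l0 + Q ^ 2 / (2 * r l0)).

Ltac derive_from_hyps x :=
  apply is_derive_Reals; auto_derive;
  [ repeat split; eapply ex_derive_of_derivable_pt_lim; eauto
  | rewrite ?(Derive_of_derivable_pt_lim _ _ _ (Hr1 x)),
      ?(Derive_of_derivable_pt_lim _ _ _ (Hr2 x)),
      ?(Derive_of_derivable_pt_lim _ _ _ (HKr1 x)),
      ?(Derive_of_derivable_pt_lim _ _ _ (HE1 x)) ].

Lemma scaled_theta_prod_eq l : 0 < l -> P l = r l ^ 2 / 4 * theta_prod r r1 Kr l.
Proof.
  intro Hl. pose proof (Hrpos l Hl).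
  unfold theta_prod, theta_plus, theta_minus, scaled_theta_prod. field. lra.
Qed.

Lemma scaled_theta_prod_deriv l : 0 < l ->
  derivable_pt_lim P l
    ((1 - P l) * r1 l / r l - 8 * PI * r l * (mu l * r1 l + j l * (r l * Kr l))).
Proof.
  intro Hl. pose proof (Hrpos l Hl).
  replace (8 * PI * r l * (mu l * r1 l + j l * (r l * Kr l))) with
    (r l * r1 l * (8 * PI * mu l) + 2 * r l ^ 2 * Kr l * (4 * PI * j l)) by ring.
  rewrite <- (Hham l Hl), <- (Hmom l Hl).
  unfold scaled_theta_prod. derive_from_hyps l. field. lra.
Qed.

Lemma misner_sharp_continuous : continuity En.
Proof.
  intro x. apply derivable_continuous_pt, ex_derive_Reals_0.
  unfold misner_sharp, scaled_theta_prod. auto_derive.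
  repeat split; eapply ex_derive_of_derivable_pt_lim; eauto.
Qed.

Lemma misner_sharp_deriv l : 0 < l ->
  derivable_pt_lim En l (4 * PI * r l ^ 2 * (mu l * r1 l + j l * (r l * Kr l))).
Proof.
  intro Hl. pose proof (Hrpos l Hl).
  replace (4 * PI * r l ^ 2 * (mu l * r1 l + j l * (r l * Kr l))) with
    (r l ^ 2 * r1 l / 2 * (8 * PI * mu l) + r l ^ 3 * Kr l * (4 * PI * j l)) by field.
  rewrite <- (Hham l Hl), <- (Hmom l Hl).
  unfold misner_sharp, scaled_theta_prod. derive_from_hyps l. field. lra.
Qed.

Lemma exterior_energy_density l : l0 <= l -> mu l = E l ^ 2 / (8 * PI).
Proof.
  intro Hl. rewrite (Hmu l ltac:(lra)), (proj1 (Hvac l Hl)). apply Rplus_0_l.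
Qed.

Lemma exterior_charge l : l0 <= l -> E l * r l ^ 2 = Q.
Proof.
  intro Hl. apply (eq_of_derivative_zero (fun x => E x * r x ^ 2)
    (fun x => E1 x * r x ^ 2 + E x * (2 * r x * r1 x)) l0 l).
  - exact Hl.
  - intros c _. derive_from_hyps c. ring.
  - intros c Hc. pose proof (Hrpos c ltac:(lra)).
    transitivity (4 * PI * rho c * r c ^ 2).
    + rewrite <- (Hmax c ltac:(lra)). field. lra.
    + rewrite (proj2 (proj2 (Hvac c ltac:(lra)))). ring.
Qed.

Lemma exterior_mass l : l0 <= l -> En l + Q ^ 2 / (2 * r l) = M.
Proof.
  intro Hl. apply (eq_of_derivative_zero (fun x => En x + Q ^ 2 / (2 * r x))
    (fun x => 4 * PI * r x ^ 2 * (mu x * r1 x + j x * (r x * Kr x))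
              - Q ^ 2 * r1 x / (2 * r x ^ 2)) l0 l).
  - exact Hl.
  - intros c Hc. pose proof (Hrpos c ltac:(lra)).
    apply derivable_pt_lim_plus; [apply misner_sharp_deriv; lra|].
    apply is_derive_Reals; auto_derive.
    { repeat split; try lra. eapply ex_derive_of_derivable_pt_lim; eauto. }
    rewrite (Derive_of_derivable_pt_lim _ _ _ (Hr1 c)). field. lra.
  - intros c Hc. pose proof (Hrpos c ltac:(lra)). pose proof PI_RGT_0.
    rewrite (exterior_energy_density c ltac:(lra)), (proj1 (proj2 (Hvac c ltac:(lra)))).
    rewrite <- (exterior_charge c ltac:(lra)). field. split; lra.
Qed.

(* [M] is the ADM mass, the limit of [En] as [r -> oo]. *)
Lemma exterior_reissner_nordstrom l : l0 <= l ->
  r l ^ 2 * P l = r l ^ 2 - 2 * M * r l + Q ^ 2.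
Proof.
  intro Hl. pose proof (Hrpos l ltac:(lra)).
  rewrite <- (exterior_mass l Hl). unfold misner_sharp. field. lra.
Qed.

Section UntrappedExterior.

Hypothesis Huntr : forall l, l0 <= l -> 0 < theta_prod r r1 Kr l.

Lemma exterior_scaled_theta_prod_pos l : l0 <= l -> 0 < P l.
Proof.
  intro Hl. pose proof (Hrpos l ltac:(lra)).
  rewrite scaled_theta_prod_eq by lra.
  apply Rmult_lt_0_compat; [nra | exact (Huntr l Hl)].
Qed.

Lemma boundary_expanding : 0 < r1 l0.
Proof.
  destruct (Haf_r1 (1 / 2)) as [L HL]; [lra|].
  assert (Hb : 0 < r1 (Rmax L l0)).
  { specialize (HL _ (Rmax_l L l0)). apply Rabs_def2 in HL. lra. }
  apply (pos_of_no_root r1 l0 (Rmax L l0) (continuity_of_derivable_pt_lim r1 r2 Hr2)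
           (Rmax_r L l0) Hb).
  intros x Hx Hroot. pose proof (exterior_scaled_theta_prod_pos x ltac:(lra)) as HP.
  unfold scaled_theta_prod in HP. rewrite Hroot in HP. nra.
Qed.

(* Where [En < 0] in the ball, [r1 > |r Kr|], so the dominant energy condition makes [En]
   nondecreasing up to [l0]. *)
Lemma boundary_misner_sharp_nonneg : 0 <= En l0.
Proof.
  destruct (Rle_or_lt 0 (En l0)) as [Hnonneg|Hneg]; [exact Hnonneg|exfalso].
  destruct (last_nonneg_point En 0 l0 misner_sharp_continuous) as [b [Hb [HEnb Hafter]]].
  - lra.
  - unfold misner_sharp. rewrite Hr0. lra.
  - exact Hneg.
  assert (Hbig : forall y, b < y <= l0 -> 1 < P y).
  { intros y Hy. pose proof (Hafter y Hy). pose proof (Hrpos y ltac:(lra)).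
    unfold misner_sharp in *. nra. }
  assert (Hexp : forall y, b < y <= l0 -> 0 < r1 y).
  { intros y Hy.
    apply (pos_of_no_root r1 y l0 (continuity_of_derivable_pt_lim r1 r2 Hr2)
             (proj2 Hy) boundary_expanding).
    intros x Hx Hroot. pose proof (Hbig x ltac:(lra)) as HP.
    unfold scaled_theta_prod in HP. rewrite Hroot in HP. nra. }
  assert (En b <= En l0); [|lra].
  apply (le_of_derivative_nonneg En
           (fun x => 4 * PI * r x ^ 2 * (mu x * r1 x + j x * (r x * Kr x))) b l0).
  - lra.
  - exact misner_sharp_continuous.
  - intros c Hc. apply misner_sharp_deriv. lra.
  - intros c Hc. pose proof PI_RGT_0.
    apply Rmult_le_pos; [nra|].
    apply dominant_energy_flux_nonneg.
    + apply Hdec. lra.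
    + pose proof (Hbig c ltac:(lra)). unfold scaled_theta_prod in *. nra.
    + pose proof (Hexp c ltac:(lra)). lra.
Qed.

(* If [2 r l0 <= |Q|], the Reissner–Nordström quadratic is [<= 0] at radius [Q^2 / (2 r l0)]. *)
Lemma untrapped_charge_bound : Rabs Q < 2 * r l0.
Proof.
  pose proof (Hrpos l0 Hl0).
  destruct (Rlt_or_le (Rabs Q) (2 * r l0)) as [Hlt|Hbig]; [exact Hlt|exfalso].
  set (t := Q ^ 2 / (2 * r l0)).
  assert (Ht : t * (2 * r l0) = Q ^ 2) by (unfold t; field; lra).
  assert (HQ2 : Q ^ 2 = Rabs Q ^ 2) by (rewrite pow2_abs; reflexivity).
  assert (HQt : Rabs Q <= t) by nra.
  assert (HMt : t <= M) by (pose proof boundary_misner_sharp_nonneg; unfold t; lra).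
  destruct (tends_to_infty_reaches r l0 t (continuity_of_derivable_pt_lim r r1 Hr1) Haf_r)
    as [z [Hz Hrz]]; [lra|].
  pose proof (exterior_reissner_nordstrom z Hz) as HRN.
  pose proof (exterior_scaled_theta_prod_pos z Hz). rewrite Hrz in HRN.
  assert (0 < t) by (pose proof (Rabs_pos Q); lra).
  assert (Q ^ 2 <= t ^ 2) by (pose proof (Rabs_pos Q); nra).
  assert (0 < t ^ 2 * P z) by (apply Rmult_lt_0_compat; nra).
  nra.
Qed.

End UntrappedExterior.

Lemma exterior_field_exceeds l : l0 <= l -> r l < Rabs Q -> 1 < E l ^ 2 * r l ^ 2.
Proof.
  intros Hl HrQ. pose proof (Hrpos l ltac:(lra)).
  assert (HQ2 : Q ^ 2 = Rabs Q ^ 2) by (rewrite pow2_abs; reflexivity).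
  assert (HQ : Q ^ 2 = E l ^ 2 * r l ^ 2 * r l ^ 2) by (rewrite <- (exterior_charge l Hl); ring).
  assert (0 < r l ^ 2) by nra.
  nra.
Qed.

Lemma horizon_not_expanding l1 : l0 <= l1 -> is_horizon r r1 Kr l1 -> r l1 < Rabs Q ->
  r1 l1 <= 0.
Proof.
  intros Hl1 [Hth [a [Ha [Hal1 Htrapped]]]] HrQ.
  destruct (Rle_or_lt (r1 l1) 0) as [Hle|Hpos]; [exact Hle|exfalso].
  pose proof (Hrpos l1 ltac:(lra)). pose proof (exterior_field_exceeds l1 Hl1 HrQ).
  assert (HP : P l1 = 0) by (rewrite scaled_theta_prod_eq, Hth by lra; ring).
  assert (HdP : (1 - P l1) * r1 l1 / r l1
                - 8 * PI * r l1 * (mu l1 * r1 l1 + j l1 * (r l1 * Kr l1)) < 0).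
  { pose proof PI_RGT_0.
    rewrite HP, (exterior_energy_density l1 Hl1), (proj1 (proj2 (Hvac l1 Hl1))).
    replace ((1 - 0) * r1 l1 / r l1
             - 8 * PI * r l1 * (E l1 ^ 2 / (8 * PI) * r1 l1 + 0 * (r l1 * Kr l1)))
      with (r1 l1 / r l1 * (1 - E l1 ^ 2 * r l1 ^ 2)) by (field; split; lra).
    assert (0 < r1 l1 / r l1) by (apply Rdiv_lt_0_compat; lra).
    nra. }
  destruct (derivable_pt_lim_neg_local P l1 _ (scaled_theta_prod_deriv l1 ltac:(lra)) HdP)
    as [del [Hdel Hloc]].
  pose proof (Rmin_l (del / 2) ((l1 - a) / 2)). pose proof (Rmin_r (del / 2) ((l1 - a) / 2)).
  assert (0 < Rmin (del / 2) ((l1 - a) / 2)) by (apply Rmin_glb_lt; lra).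
  set (h := Rmin (del / 2) ((l1 - a) / 2)) in *.
  destruct (Hloc h ltac:(lra)) as [_ Hleft].
  assert (P (l1 - h) < 0).
  { pose proof (Hrpos (l1 - h) ltac:(lra)). pose proof (Htrapped (l1 - h) ltac:(lra)).
    rewrite scaled_theta_prod_eq by lra. apply Rmult_pos_neg; [nra | assumption]. }
  lra.
Qed.

(* When [r1 l1 = 0] the Hamiltonian constraint gives [2 r r2 = 1 - E^2 r^2 < 0]. *)
Lemma horizon_contracting_beyond l1 : l0 <= l1 -> P l1 = 0 -> r l1 < Rabs Q -> r1 l1 <= 0 ->
  exists l2, l1 < l2 /\ r l2 < r l1.
Proof.
  intros Hl1 HP HrQ Hle. pose proof (Hrpos l1 ltac:(lra)).
  destruct (Rle_lt_or_eq_dec _ _ Hle) as [Hneg|Hzero].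
  - destruct (derivable_pt_lim_neg_local r l1 _ (Hr1 l1) Hneg) as [del [Hdel Hloc]].
    exists (l1 + del / 2). split; [lra|]. apply Hloc. lra.
  - apply (exists_right_lt_of_second_derivative_neg r r1 l1 (r2 l1) Hr1 (Hr2 l1) Hzero).
    assert (HK : Kr l1 = 0).
    { unfold scaled_theta_prod in HP. rewrite Hzero in HP.
      assert (r l1 * Kr l1 = 0) by nra. nra. }
    pose proof (Hham l1 ltac:(lra)) as Hh. pose proof PI_RGT_0.
    rewrite HK, Hzero, (exterior_energy_density l1 Hl1) in Hh.
    assert (HA : (0 ^ 2 + 2 * r l1 * r2 l1 - 1) / r l1 ^ 2 = - E l1 ^ 2).
    { replace (E l1 ^ 2) with (8 * PI * (E l1 ^ 2 / (8 * PI))) by (field; lra). lra. }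
    assert (Hr2eq : 2 * r l1 * r2 l1 = 1 - E l1 ^ 2 * r l1 ^ 2).
    { replace (2 * r l1 * r2 l1) with ((0 ^ 2 + 2 * r l1 * r2 l1 - 1) / r l1 ^ 2 * r l1 ^ 2 + 1)
        by (field; lra).
      rewrite HA. ring. }
    pose proof (exterior_field_exceeds l1 Hl1 HrQ). nra.
Qed.

(* A horizon of radius [< |Q|] is the smaller root of the Reissner–Nordström quadratic; the
   critical point of [r] beyond it has smaller radius but [P <= 0] there. *)
Lemma horizon_charge_bound l1 : l0 <= l1 -> is_horizon r r1 Kr l1 -> Rabs Q <= r l1.
Proof.
  intros Hl1 Hhor.
  destruct (Rle_or_lt (Rabs Q) (r l1)) as [Hle|HrQ]; [exact Hle|exfalso].
  pose proof (Hrpos l1 ltac:(lra)).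
  assert (HP : P l1 = 0) by (rewrite scaled_theta_prod_eq, (proj1 Hhor) by lra; ring).
  destruct (horizon_contracting_beyond l1 Hl1 HP HrQ (horizon_not_expanding l1 Hl1 Hhor HrQ))
    as [l2 [Hl12 Hr12]].
  destruct (exists_critical_point_below r r1 l1 l2 Hr1 Haf_r Hl12 Hr12) as [m [Hm [Hrm Hcrit]]].
  pose proof (Hrpos m ltac:(lra)).
  assert (HPm : P m <= 0) by (unfold scaled_theta_prod; rewrite Hcrit; nra).
  pose proof (exterior_reissner_nordstrom m ltac:(lra)) as HRNm.
  pose proof (exterior_reissner_nordstrom l1 Hl1) as HRN1. rewrite HP in HRN1.
  assert (HQ2 : Q ^ 2 = Rabs Q ^ 2) by (rewrite pow2_abs; reflexivity).
  assert (0 < r m ^ 2 - 2 * M * r m + Q ^ 2).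
  { apply (quadratic_pos_below_smaller_root _ _ (r l1)); [lra | nra | lra]. }
  nra.
Qed.

End EinsteinMaxwellData.

Theorem theorem1
  (r r1 r2 Kl Kr Kr1 E E1 mu muM j rho : R -> R) (l0 : R)
  (* regularity *)
  (Hr_smooth : smooth r) (HKl_smooth : smooth Kl) (HKr_smooth : smooth Kr)
  (HE_smooth : smooth E)
  (Hr1 : forall l, derivable_pt_lim r l (r1 l))
  (Hr2 : forall l, derivable_pt_lim r1 l (r2 l))
  (HKr1 : forall l, derivable_pt_lim Kr l (Kr1 l))
  (HE1 : forall l, derivable_pt_lim E l (E1 l))
  (Hr0 : r 0 = 0) (Hr10 : r1 0 = 1) (Hrpos : forall l, 0 < l -> 0 < r l)
  (* constraint equations *)
  (Hham : forall l, 0 < l ->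
     Kr l * (Kr l + 2 * Kl l) - (r1 l ^ 2 + 2 * r l * r2 l - 1) / r l ^ 2
       = 8 * PI * mu l)
  (Hmom : forall l, 0 < l -> Kr1 l + r1 l / r l * (Kr l - Kl l) = 4 * PI * j l)
  (* Maxwell (B = 0: no magnetic charge) *)
  (Hmax : forall l, 0 < l ->
     (E1 l * r l ^ 2 + 2 * E l * r l * r1 l) / r l ^ 2 = 4 * PI * rho l)
  (Hmu : forall l, 0 < l -> mu l = muM l + E l ^ 2 / (8 * PI))
  (* the ball B = {l <= l0} *)
  (Hl0 : 0 < l0)
  (Hvac : forall l, l0 <= l -> muM l = 0 /\ j l = 0 /\ rho l = 0)
  (Hdec : forall l, 0 < l <= l0 -> Rabs (j l) <= mu l)
  (* asymptotic flatness *)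
  (Haf_r : tends_to_infty r)
  (Haf_r1 : tends_to_at_infty r1 1)
  (Haf_K : tends_to_at_infty (fun l => r l * Kr l) 0)
  (* nonzero charge Q = E(l0) r(l0)^2 *)
  (HQ : E l0 * r l0 ^ 2 <> 0) :
  ((forall l, l0 <= l -> 0 < theta_prod r r1 Kr l) ->
     Rabs (E l0 * r l0 ^ 2) < 2 * r l0)
  /\
  (forall l1, l0 <= l1 -> is_horizon r r1 Kr l1 ->
     Rabs (E l0 * r l0 ^ 2) <= r l1).
Proof.
  split.
  - intro Huntr.
    eapply (untrapped_charge_bound r r1 r2 Kl Kr Kr1 E E1 mu muM j rho l0); eassumption.
  - intros l1 Hl1 Hhor.
    eapply (horizon_charge_bound r r1 r2 Kl Kr Kr1 E E1 mu muM j rho l0); eassumption.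
Qed.
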